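(* (Prime Decomposition Theorem.) Let $(G,\sigma)$ be a connected signed graph and let $D$ be the prime decomposition of the graph $G$. Then $(G,\sigma)$ admits a prime $s$-decomposition $D_s$, which is unique up to the order of the factors and up to replacing each factor by an equivalent signed graph. Moreover, viewing $D_s$ (by forgetting signatures) as a decomposition of $G$, $D$ is finer than $D_s$.
   Context: A signed graph $(G,\sigma)$ is a simple loopless undirected graph with a signature $\sigma:E(G)\to\{+1,-1\}$. Switching a vertex negates the signs of its incident edges. Two signed graphs $(G,\sigma)$ and $(H,\pi)$ are equivalent, written $(G,\sigma)\equiv(H,\pi)$, if there is a graph isomorphism $G\to H$ carrying $\sigma$ to a signature obtained from $\pi$ by switching a set of vertices. The Cartesian product $(G,\sigma)\,\square\,(H,\pi)$ is the signed graph on $G\,\square\,H$ where $(u,v_1)(u,v_2)$ has sign $\pi(v_1v_2)$ and $(u_1,v)(u_2,v)$ has sign $\sigma(u_1u_2)$. A signed graph is $s$-prime if it is not equivalent to $(A,\pi_A)\,\square\,(B,\pi_B)$ for any signed graphs $(A,\pi_A),(B,\pi_B)$ each with at least two vertices. An $s$-decomposition of a connected signed graph $(G,\sigma)$ is a multiset $\{(G_1,\pi_1),\dots,(G_k,\pi_k)\}$, $k\ge1$, of signed graphs each with at least one edge such that $(G,\sigma)\equiv(G_1,\pi_1)\,\square\cdots\square\,(G_k,\pi_k)$; it is prime if all factors are $s$-prime. For ordinary graphs, a graph is prime if it is not $A\,\square\,B$ with $A,B$ on at least two vertices; a decomposition of $G$ is a multiset $\{G_1,\dots,G_k\}$ of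 graphs with at least one edge with $G\cong G_1\,\square\cdots\square\,G_k$, prime if all $G_i$ are prime (the prime decomposition of a connected graph is unique up to isomorphism and order). A decomposition $D'$ is finer than $D=\{G_1,\dots,G_k\}$ if each $G_i$ has a decomposition $\{G'_{i,1},\dots,G'_{i,p_i}\}$ and $D'$ is the union of these multisets. *)

(* Defs.v *)
From Stdlib Require List.
From mathcomp Require Import all_boot.
Set Implicit Arguments. Unset Strict Implicit. Unset Printing Implicit Defensive.

Record graph := Graph {
  gV : finType;
  gadj : rel gV;
  gadj_sym : symmetric gadj;
  gadj_irr : irreflexive gadj }.

(* The trivial graph K1 (one vertex, no edge); only used as the value of the
   empty Cartesian product, which never occurs in decompositions (k >= 1). *)
Definition K1 : graph := @Graph unit (fun _ _ => false) (fun _ _ => erefl) (fun _ => erefl).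

Definition gprod_adj (A B : graph) : rel (gV A * gV B) :=
  fun x y => ((x.1 == y.1) && gadj x.2 y.2) || ((x.2 == y.2) && gadj x.1 y.1).
Arguments gprod_adj : clear implicits.

Lemma gprod_adj_sym (A B : graph) : symmetric (gprod_adj A B).
Proof.
by move=> x y; rewrite /gprod_adj eq_sym [x.2 == _]eq_sym gadj_sym (@gadj_sym A x.1).
Qed.

Lemma gprod_adj_irr (A B : graph) : irreflexive (gprod_adj A B).
Proof. by move=> x; rewrite /gprod_adj !gadj_irr !andbF. Qed.

Definition gprod (A B : graph) : graph :=
  @Graph (gV A * gV B)%type (gprod_adj A B) (@gprod_adj_sym A B) (@gprod_adj_irr A B).

Fixpoint gprodl (s : seq graph) : graph :=
  match s with
  | [::] => K1
  | G :: s' => match s' with [::] => G | _ => gprod G (gprodl s') end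
  end.

Definition giso (G H : graph) : Prop :=
  exists f : gV G -> gV H, bijective f /\ forall u v, gadj u v = gadj (f u) (f v).

Definition has_edge (G : graph) : Prop := exists u v : gV G, gadj u v.

Definition gconnected (G : graph) : Prop := forall u v : gV G, connect (@gadj G) u v.

Definition gprime (G : graph) : Prop :=
  ~ exists A B : graph, [/\ 1 < #|gV A|, 1 < #|gV B| & giso G (gprod A B)].

(* [perm_up R s t]: there is a bijection between the entries of s and t
   matching R-related entries (multiset equality up to R). *)
Inductive perm_up (A B : Type) (R : A -> B -> Prop) : seq A -> seq B -> Prop :=
| perm_up_nil : perm_up R [::] [::]
| perm_up_cons x y s t1 t2 :
    R x y -> perm_up R s (t1 ++ t2) -> perm_up R (x :: s) (t1 ++ y :: t2).

Definition is_decomp (G : graph) (D : seq graph) : Prop :=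
  [/\ 0 < size D, forall H, List.In H D -> has_edge H & giso G (gprodl D)].

Definition is_prime_decomp (G : graph) (D : seq graph) : Prop :=
  is_decomp G D /\ forall H, List.In H D -> gprime H.

Definition finer (D' D : seq graph) : Prop :=
  exists P : seq (seq graph),
    [/\ size P = size D,
        forall i, i < size D -> is_decomp (nth K1 D i) (nth [::] P i)
      & perm_up giso D' (flatten P)].

(* A signature is a symmetric sign function; [true] encodes -1, [false]
   encodes +1.  Only its values on edges are relevant. *)
Record sgraph := SGraph {
  sg : graph;
  sgn : gV sg -> gV sg -> bool;
  sgn_sym : forall u v, sgn u v = sgn v u }.

(* Equivalence: an isomorphism f : G -> H carrying sigma to the signature
   obtained from pi by switching the vertex set X of H (switching a vertex
   negates its incident edges, i.e. xor with membership of both ends). *)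
Definition sequiv (S T : sgraph) : Prop :=
  exists f : gV (sg S) -> gV (sg T),
    [/\ bijective f, forall u v, gadj u v = gadj (f u) (f v)
      & exists X : {set gV (sg T)}, forall u v, gadj u v ->
          sgn u v = sgn (f u) (f v) (+) (f u \in X) (+) (f v \in X)].

Definition sgprod_sgn (A B : sgraph) (x y : gV (sg A) * gV (sg B)) : bool :=
  if x.1 == y.1 then sgn x.2 y.2 else sgn x.1 y.1.
Arguments sgprod_sgn : clear implicits.

Lemma sgprod_sgn_sym (A B : sgraph) x y : sgprod_sgn A B x y = sgprod_sgn A B y x.
Proof. by rewrite /sgprod_sgn eq_sym sgn_sym (@sgn_sym A x.1). Qed.

Definition sgprod (A B : sgraph) : sgraph :=
  @SGraph (gprod (sg A) (sg B)) (sgprod_sgn A B) (@sgprod_sgn_sym A B).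

Definition sK1 : sgraph := @SGraph K1 (fun _ _ => false) (fun _ _ => erefl).

Fixpoint sgprodl (s : seq sgraph) : sgraph :=
  match s with
  | [::] => sK1
  | T :: s' => match s' with [::] => T | _ => sgprod T (sgprodl s') end
  end.

Definition sprime (S : sgraph) : Prop :=
  ~ exists A B : sgraph,
      [/\ 1 < #|gV (sg A)|, 1 < #|gV (sg B)| & sequiv S (sgprod A B)].

Definition is_sdecomp (S : sgraph) (D : seq sgraph) : Prop :=
  [/\ 0 < size D, forall T, List.In T D -> has_edge (sg T) & sequiv S (sgprodl D)].

Definition is_prime_sdecomp (S : sgraph) (D : seq sgraph) : Prop :=
  is_sdecomp S D /\ forall T, List.In T D -> sprime T.

(* Main.v *)
(* Distances in a Cartesian product add up, so the layers of a product are
   convex, and a convex set in a product, containing a point a, is the box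
   spanned by its intersections with the layers through a; the induced signed
   subgraph on it is then equivalent to the product of those on these
   intersections.  Applied to the layers of two factorizations A x B and C x E
   of the same connected signed graph, this gives a common refinement into the
   four signed graphs induced on pairwise intersections of layers.  Unique
   factorization, cancellation included, follows formally from refinement.
   Unsigned graphs are the case of constant signatures, and the uniqueness of
   their prime decomposition shows that D arises by decomposing the underlying
   graphs of the factors in D_s. *)
Require Import Defs.
From Stdlib Require Import Classical.
From mathcomp Require Import all_boot.
Set Implicit Arguments. Unset Strict Implicit. Unset Printing Implicit Defensive.

(** * Signed equivalence and products *)

Ltac addb_cases :=
  repeat match goal with
  | |- context [addb ?x ?y] =>
    let split_atom b :=
      lazymatch b with addb _ _ => fail | true => fail | false => fail
                     | _ => case: b end in
    first [split_atom x | split_atom y]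
  end.

(** The switching is a boolean function on the source instead of a vertex set of the target, so that
    switchings compose, restrict and multiply as plain xors. *)
Lemma sequivI (S T : sgraph) (f : gV (sg S) -> gV (sg T)) g
    (t : gV (sg S) -> bool) :
  cancel f g -> cancel g f -> (forall u v, gadj u v = gadj (f u) (f v)) ->
  (forall u v, gadj u v -> sgn u v = sgn (f u) (f v) (+) t u (+) t v) ->
  sequiv S T.
Proof.
move=> fK gK fadj fsgn; exists f; split=> //; first by exists g.
by exists [set y | t (g y)] => u v uv; rewrite !inE !fK fsgn.
Qed.

Lemma sequivE (S T : sgraph) : sequiv S T ->
  exists f g (t : gV (sg S) -> bool),
    [/\ cancel f g, cancel g f, forall u v, gadj u v = gadj (f u) (f v)
      & forall u v, gadj u v ->
          sgn u v = sgn (f u : gV (sg T)) (f v) (+) t u (+) t v].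
Proof.
case=> f [[g fK gK] fadj [X fsgn]].
by exists f, g, (fun u => f u \in X).
Qed.

Lemma sequiv_refl S : sequiv S S.
Proof.
by apply: (@sequivI S S id id (fun=> false)) => // u v _; rewrite !addbF.
Qed.

Lemma sequiv_sym S T : sequiv S T -> sequiv T S.
Proof.
move=> /sequivE[f [g [t [fK gK fadj fsgn]]]].
have gadjE u v : gadj u v = gadj (g u) (g v) by rewrite fadj !gK.
apply: (sequivI (t := t \o g) gK fK) => // u v; rewrite gadjE => /fsgn -> /=.
by rewrite !gK; addb_cases.
Qed.

Lemma sequiv_trans T S U : sequiv S T -> sequiv T U -> sequiv S U.
Proof.
move=> /sequivE[f [g [t [fK gK fadj fsgn]]]].
move=> /sequivE[f' [g' [t' [fK' gK' fadj' fsgn']]]].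
apply: (sequivI (f := f' \o f) (t := fun u => t u (+) t' (f u))
                (can_comp fK' fK) (can_comp gK gK')) => [u v | u v uv] /=.
  by rewrite fadj fadj'.
rewrite fsgn // fsgn' -?fadj //.
by addb_cases.
Qed.

Lemma sequiv_card S T : sequiv S T -> #|gV (sg S)| = #|gV (sg T)|.
Proof. by case=> f [/bij_eq_card]. Qed.

Lemma sequiv_sgprod S S' T T' :
  sequiv S S' -> sequiv T T' -> sequiv (sgprod S T) (sgprod S' T').
Proof.
move=> /sequivE[f [g [t [fK gK fadj fsgn]]]].
move=> /sequivE[f' [g' [t' [fK' gK' fadj' fsgn']]]].
(* An edge of the product fixes one coordinate, so the switching of that coordinate cancels and only
   the other one acts. *)
apply: (@sequivI (sgprod S T) (sgprod S' T') (fun x => (f x.1, f' x.2))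
         (fun x => (g x.1, g' x.2)) (fun x => t x.1 (+) t' x.2)).
- by case=> x y /=; rewrite fK fK'.
- by case=> x y /=; rewrite gK gK'.
- move=> [x y] [x' y'].
  by rewrite /= /gprod_adj /= !(can_eq fK, can_eq fK') -fadj -fadj'.
- move=> [x y] [x' y']; rewrite /= /gprod_adj /sgprod_sgn /= (can_eq fK).
  case: eqP => [<-|_] /=.
  + by rewrite gadj_irr andbF orbF => /fsgn' ->; addb_cases.
  + by case/andP=> /eqP<- /fsgn ->; addb_cases.
Qed.

Lemma sgprodC S T : sequiv (sgprod S T) (sgprod T S).
Proof.
apply: (@sequivI (sgprod S T) (sgprod T S) (fun x => (x.2, x.1))
         (fun x => (x.2, x.1)) (fun=> false)).
- by case.
- by case.
- by move=> [x y] [x' y']; rewrite /= /gprod_adj /= orbC.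
(* [sgprod_sgn] tests the first coordinate only, so the swap can change the sign only on pairs
   agreeing in both coordinates or in neither; these are not edges. *)
- move=> [x y] [x' y']; rewrite /= /gprod_adj /sgprod_sgn /= !addbF.
  by case: eqP => [<-|_] /=; case: eqP => [e|_] //=; rewrite -?e !gadj_irr.
Qed.

Lemma sgprodA S T U :
  sequiv (sgprod S (sgprod T U)) (sgprod (sgprod S T) U).
Proof.
apply: (@sequivI (sgprod S (sgprod T U)) (sgprod (sgprod S T) U)
         (fun x => ((x.1, x.2.1), x.2.2))
         (fun x => (x.1.1, (x.1.2, x.2))) (fun=> false)).
- by case=> ? [].
- by case=> [[]].
- move=> [x [y z]] [x' [y' z']]; rewrite /= /gprod_adj /= /gprod_adj /= !xpair_eqE.
  by case: (x == x'); case: (y == y'); case: (z == z');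
     rewrite /= ?orbF ?orbA.
- move=> [x [y z]] [x' [y' z']]; rewrite /= /sgprod_sgn /= /sgprod_sgn /= !addbF.
  by rewrite xpair_eqE; case: (x == x'); case: (y == y').
Qed.

Lemma sgprod_trivl S T : #|gV (sg T)| = 1 -> sequiv (sgprod T S) S.
Proof.
move=> T1; have /fintype1P[a aP] : #|gV (sg T)| == 1 by rewrite T1.
apply: (@sequivI (sgprod T S) S snd (fun y => (a, y)) (fun=> false)) => //.
- by case=> x y; rewrite (aP x).
- move=> [x y] [x' y']; rewrite /= /gprod_adj /= (aP x) (aP x') eqxx.
  by rewrite gadj_irr andbF orbF.
- move=> [x y] [x' y'] _.
  by rewrite /= /sgprod_sgn /= (aP x) (aP x') eqxx !addbF.
Qed.

(** * Walks and convexity *)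

Fixpoint walk (G : graph) (n : nat) (x y : gV G) : bool :=
  if n is m.+1 then [exists z, gadj x z && walk m z y] else x == y.

Definition walk_connected (G : graph) : Prop :=
  forall x y : gV G, exists n, walk n x y.

Lemma walk_cat G n m (y x z : gV G) : walk n x y -> walk m y z -> walk (n + m) x z.
Proof.
elim: n x => [|n IH] x /=; first by move/eqP->.
case/existsP=> u /andP[xu uy] yz; apply/existsP; exists u.
by rewrite xu (IH u).
Qed.

Lemma gconnected_walk G : gconnected G -> walk_connected G.
Proof.
move=> cG x y; have /connectP[p xp ->] := cG x y; exists (size p).
elim: p x xp => [|z p IH] x //= /andP[xz zp].
by apply/existsP; exists z; rewrite xz IH.
Qed.

Lemma walk_hom (G H : graph) (f : gV G -> gV H) n x y :
  (forall u v, gadj u v -> gadj (f u) (f v)) -> walk n x y -> walk n (f x) (f y).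
Proof.
move=> fadj; elim: n x => [|n IH] x /=; first by move/eqP->.
case/existsP=> z /andP[xz zy]; apply/existsP; exists (f z).
by rewrite fadj ?IH.
Qed.

Lemma walk_iso (G H : graph) (f : gV G -> gV H) n x y :
  bijective f -> (forall u v, gadj u v = gadj (f u) (f v)) ->
  walk n x y = walk n (f x) (f y).
Proof.
move=> [g fK gK] fadj; apply/idP/idP; first by apply: walk_hom => u v; rewrite fadj.
rewrite -{2}(fK x) -{2}(fK y); apply: walk_hom => u v.
by rewrite fadj !gK.
Qed.

(** Each step in a product moves exactly one coordinate, so a walk is a shuffle of one walk per
    factor; conversely the two walks can be run one after the other. This is where distances add
    up. *)
Lemma walk_gprodP (A B : graph) n (x y : gV (gprod A B)) :
  reflect (exists k l, [/\ n = k + l, walk k x.1 y.1 & walk l x.2 y.2])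
          (walk n x y).
Proof.
apply: (iffP idP); last first.
  case: x y => [a b] [a' b'] [k [l [-> /= wa wb]]].
  apply: (@walk_cat _ _ _ ((a', b) : gV (gprod A B))).
    apply: (walk_hom (f := fun u => (u, b) : gV (gprod A B)) _ wa) => u v uv.
    by rewrite /= /gprod_adj /= eqxx uv orbT.
  apply: (walk_hom (f := fun u => (a', u) : gV (gprod A B)) _ wb) => u v uv.
  by rewrite /= /gprod_adj /= eqxx uv.
elim: n x => [|n IH] x /=; first by move/eqP->; exists 0, 0 => /=; rewrite !eqxx.
case/existsP=> z /andP[xz /IH[k [l [-> wa wb]]]].
case/orP: xz => /andP[/eqP e xz].
  exists k, l.+1; rewrite addnS e; split=> //=.
  by apply/existsP; exists z.2; rewrite xz.
exists k.+1, l; rewrite addSn e; split=> //=.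
by apply/existsP; exists z.1; rewrite xz.
Qed.

(** Geodesic convexity without a distance function: [n + m] is at most the length of any walk from
    [x] to [y], so [z] lies on a shortest one. *)
Definition convex (G : graph) (W : {set gV G}) : Prop :=
  forall x y z n m, x \in W -> y \in W -> walk n x z -> walk m z y ->
    (forall k, walk k x y -> n + m <= k) -> z \in W.

(** The ends of the geodesic agree in the second coordinate, so its steps there could be dropped;
    minimality says that there are none. *)
Lemma layer_convex (G A B : graph) (f : gV G -> gV (gprod A B)) b :
  bijective f -> (forall u v, gadj u v = gadj (f u) (f v)) ->
  convex [set x | (f x).2 == b].
Proof.
move=> bf fadj x y z n m; rewrite !inE => /eqP xb /eqP yb.
rewrite !(walk_iso _ _ _ bf fadj) => /walk_gprodP[n1 [n2 [-> xz1 xz2]]].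
case/walk_gprodP=> [m1 [m2 [-> zy1 _]]] /(_ (n1 + m1)).
rewrite (walk_iso _ _ _ bf fadj) => le_nm.
have {le_nm}/le_nm : walk (n1 + m1) (f x) (f y).
  apply/walk_gprodP; exists (n1 + m1), 0; rewrite addn0; split=> //=.
    exact: walk_cat xz1 zy1.
  by rewrite xb yb.
rewrite addnACA -{2}[n1 + m1]addn0 leq_add2l leqn0 addn_eq0 => /andP[/eqP n20 _].
by move: xz2; rewrite n20 /= xb eq_sym.
Qed.

Lemma geodesic_walk (G : graph) (x y : gV G) n : walk n x y ->
  exists2 m, walk m x y & forall k, walk k x y -> m <= k.
Proof.
move=> xy; have ex : exists m, walk m x y by exists n.
by case: (ex_minnP ex) => m; exists m.
Qed.

(* The corner (x.1, y.2) lies on a geodesic from x to y, since distances in a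
   Cartesian product add up. *)
Lemma convex_corner (G A B : graph) (f : gV G -> gV (gprod A B)) W x y z :
  bijective f -> (forall u v, gadj u v = gadj (f u) (f v)) ->
  walk_connected G -> convex W -> x \in W -> y \in W ->
  f z = ((f x).1, (f y).2) -> z \in W.
Proof.
move=> bf fadj cG cW xW yW fz.
have [n0] := cG x y; rewrite (walk_iso _ _ _ bf fadj) => /walk_gprodP.
case=> [k0 [l0 [_ /geodesic_walk[k wk kmin] /geodesic_walk[l wl lmin]]]].
apply: (cW x y z l k xW yW) => [||i].
- rewrite (walk_iso _ _ _ bf fadj) fz; apply/walk_gprodP.
  by exists 0, l; rewrite /= eqxx.
- rewrite (walk_iso _ _ _ bf fadj) fz; apply/walk_gprodP.
  by exists k, 0; rewrite addn0 /= eqxx.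
- rewrite (walk_iso _ _ _ bf fadj) => /walk_gprodP[i1 [i2 [-> /kmin ? /lmin ?]]].
  by rewrite addnC leq_add.
Qed.

(** * Induced signed subgraphs and common refinement *)

Definition induced_graph (G : graph) (W : {set gV G}) : graph :=
  @Graph {x | x \in W} (fun x y => gadj (val x) (val y))
    (fun x y => gadj_sym (val x) (val y)) (fun x => gadj_irr (val x)).

Definition induced (S : sgraph) (W : {set gV (sg S)}) : sgraph :=
  @SGraph (induced_graph W) (fun x y => sgn (val x) (val y))
    (fun x y => sgn_sym (val x) (val y)).

(** The layer is a copy of [A] through [u |-> g (u, b)], and the switching is [t] restricted to
    it. *)
Lemma layer_sequiv (S A B : sgraph) (f : gV (sg S) -> gV (gprod (sg A) (sg B)))
    g (t : gV (sg S) -> bool) b :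
  cancel f g -> cancel g f -> (forall u v, gadj u v = gadj (f u) (f v)) ->
  (forall u v, gadj u v ->
     sgn u v = sgprod_sgn A B (f u) (f v) (+) t u (+) t v) ->
  sequiv A (induced [set x | (f x).2 == b]).
Proof.
move=> fK gK fadj fsgn; apply: sequiv_sym.
set W := [set x | _].
have gW u : g (u, b) \in W by rewrite inE gK.
have Wb (x : {x | x \in W}) : (f (val x)).2 = b.
  by have := valP x; rewrite inE => /eqP.
apply: (@sequivI (induced W) A (fun x => (f (val x)).1)
         (fun u => exist _ (g (u, b)) (gW u)) (fun x => t (val x))).
- by move=> x; apply: val_inj; rewrite /= -(Wb x) -surjective_pairing fK.
- by move=> u; rewrite /= gK.
- by move=> x y; rewrite /= fadj /= /gprod_adj !Wb eqxx gadj_irr andbF.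
- move=> x y; rewrite /= => xy; rewrite fsgn //; move: xy.
  rewrite fadj /= /gprod_adj /sgprod_sgn !Wb gadj_irr andbF eqxx /=.
  by case: eqP => [->|//]; rewrite gadj_irr.
Qed.

(** With two vertices, [W] also contains the vertex combining their coordinates, so it is a box
    whose sides are its slices through [a]. *)
Lemma convex_sequiv (S C E : sgraph) (f : gV (sg S) -> gV (gprod (sg C) (sg E)))
    g (t : gV (sg S) -> bool) (W : {set gV (sg S)}) a :
  cancel f g -> cancel g f -> (forall u v, gadj u v = gadj (f u) (f v)) ->
  (forall u v, gadj u v ->
     sgn u v = sgprod_sgn C E (f u) (f v) (+) t u (+) t v) ->
  walk_connected (sg S) -> convex W -> a \in W ->
  sequiv (induced W)
    (sgprod (induced (W :&: [set x | (f x).2 == (f a).2]))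
            (induced (W :&: [set x | (f x).1 == (f a).1]))).
Proof.
move=> fK gK fadj fsgn cS cW aW.
have bf : bijective f by exists g.
have corner x y : x \in W -> y \in W -> g ((f x).1, (f y).2) \in W.
  by move=> xW yW; apply: (convex_corner bf fadj cS cW xW yW); rewrite gK.
set WC := W :&: _; set WE := W :&: _.
have inC (x : {x | x \in W}) : g ((f (val x)).1, (f a).2) \in WC.
  by rewrite !inE gK eqxx andbT corner // (valP x).
have inE' (x : {x | x \in W}) : g ((f a).1, (f (val x)).2) \in WE.
  by rewrite !inE gK eqxx andbT corner // (valP x).
have inW (x : {x | x \in WC} * {x | x \in WE}) :
    g ((f (val x.1)).1, (f (val x.2)).2) \in W.
  have := valP x.1; have := valP x.2; rewrite !inE => /andP[? _] /andP[? _].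
  exact: corner.
(* Along an edge one of the two projections of x is constant, so its switching
   cancels, while that of the other projection corrects the sign. *)
apply: (@sequivI (induced W) (sgprod (induced WC) (induced WE))
  (fun x => (exist (fun y => y \in WC) _ (inC x),
             exist (fun y => y \in WE) _ (inE' x)))
  (fun x => exist (fun y => y \in W) _ (inW x))
  (fun x => t (val x) (+) t (g ((f (val x)).1, (f a).2))
                      (+) t (g ((f a).1, (f (val x)).2)))).
- by move=> x; apply: val_inj; rewrite /= !gK /= -surjective_pairing fK.
- move=> [y z]; congr pair; apply: val_inj; rewrite /= gK /=.
    have := valP y; rewrite !inE => /andP[_ /eqP <-].
    by rewrite -surjective_pairing fK.
  have := valP z; rewrite !inE => /andP[_ /eqP <-].
  by rewrite -surjective_pairing fK.
- move=> x y; rewrite /= /gprod_adj /= fadj -!val_eqE /= !(can_eq gK).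
  rewrite !xpair_eqE !eqxx ?andbT /= !fadj !gK /= /gprod_adj /= !eqxx /=.
  by rewrite !gadj_irr !andbF /= orbF.
- move=> x y; rewrite /= => xy; rewrite fsgn //; move: xy.
  rewrite fadj /= /gprod_adj /sgprod_sgn -!val_eqE /= (can_eq gK).
  rewrite xpair_eqE eqxx andbT.
  case: eqP => [e|ne] /=.
    rewrite -e gadj_irr andbF orbF => xy.
    rewrite fsgn; last by rewrite fadj /= !gK /gprod_adj /= eqxx xy.
    by rewrite !gK /sgprod_sgn /= eqxx; addb_cases.
  case/andP=> /eqP e xy.
  rewrite fsgn; last by rewrite fadj /= !gK /gprod_adj /= eqxx xy orbT.
  rewrite !gK /sgprod_sgn /= e; move/eqP/negPf: ne => ->.
  by addb_cases.
Qed.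

(** Nonemptiness is asked for separately, as the empty graph is connected; it supplies the vertex
    through which all layers are taken. *)
Definition proper_conn (S : sgraph) : Prop :=
  0 < #|gV (sg S)| /\ walk_connected (sg S).

Lemma sgprod_refinement (A B C E : sgraph) :
  proper_conn (sgprod A B) -> sequiv (sgprod A B) (sgprod C E) ->
  exists X Y Z W : sgraph,
    [/\ sequiv A (sgprod X Y), sequiv B (sgprod Z W),
        sequiv C (sgprod X Z) & sequiv E (sgprod Y W)].
Proof.
set S := sgprod A B => [[/card_gt0P[a _] cS]] eCE.
(* Stated for any factorization, to be used both for [A], [B] and for [C], [E], with all layers
   through the same [a]. *)
have both (P Q : sgraph) : sequiv S (sgprod P Q) ->
    exists2 L : {set gV (sg S)} * {set gV (sg S)},
      [/\ a \in L.1, a \in L.2, convex L.1 & convex L.2] &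
      [/\ sequiv P (induced L.1), sequiv Q (induced L.2) &
       forall V, convex V -> a \in V ->
         sequiv (induced V) (sgprod (induced (V :&: L.1)) (induced (V :&: L.2)))].
  move=> eS; have /sequivE[f [g [t [fK gK fadj fsgn]]]] := eS.
  (* Exchanging the coordinates lets the lemmas on layers, stated for the first factor, apply to the
     second. *)
  pose f' (x : gV (sg S)) : gV (gprod (sg Q) (sg P)) := ((f x).2, (f x).1).
  pose g' (x : gV (gprod (sg Q) (sg P))) : gV (sg S) := g (x.2, x.1).
  have fK' : cancel f' g' by move=> x; rewrite /g' /= -surjective_pairing fK.
  have gK' : cancel g' f' by case=> x y; rewrite /f' gK.
  have fadj' (u v : gV (sg S)) : gadj u v = gadj (f' u) (f' v).
    by rewrite fadj /= /gprod_adj /= orbC.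
  have fsgn' (u v : gV (sg S)) : gadj u v -> sgn u v =
      sgprod_sgn Q P (f' u) (f' v) (+) t u (+) t v.
    move=> uv; rewrite (fsgn _ _ uv); move: uv; rewrite fadj /= /gprod_adj.
    rewrite /sgprod_sgn /=; case: eqP => [->|_] /=; case: eqP => [e|_] //=.
    by rewrite e !gadj_irr.
  exists ([set x | (f x).2 == (f a).2], [set x | (f x).1 == (f a).1]).
    split; rewrite ?inE //=; first by apply: layer_convex => //; exists g.
    by apply: (@layer_convex _ _ _ f' (f a).1) => //; exists g'.
  split=> /=; first exact: layer_sequiv fsgn.
    exact: (layer_sequiv (f a).1 fK' gK' fadj' fsgn').
  by move=> V cV aV; apply: (convex_sequiv fK gK fadj fsgn cS cV aV).
have [[LA LB] /= [aA aB cA cB] [eA eB boxAB]] := both A B (sequiv_refl _).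
have [[LC LE] /= [aC aE cC cE] [eC eE boxCE]] := both C E eCE.
(* Each layer of one factorization is convex, so the other factorization cuts it into two of these
   four intersections. *)
exists (induced (LA :&: LC)), (induced (LA :&: LE)),
       (induced (LB :&: LC)), (induced (LB :&: LE)); split.
- by apply: sequiv_trans eA _; apply: boxCE.
- by apply: sequiv_trans eB _; apply: boxCE.
- by apply: sequiv_trans eC _; rewrite ![_ :&: LC]setIC; apply: boxAB.
- by apply: sequiv_trans eE _; rewrite ![_ :&: LE]setIC; apply: boxAB.
Qed.

(** * Unique factorization in refinement monoids *)

(* [rm_conn] carries connectedness: without it, refinement, hence uniqueness
   of factorizations, fails. *)
Record refinement_monoid := RefinementMonoid {
  rm_car :> Type;
  rm_eq : rm_car -> rm_car -> Prop;
  rm_mul : rm_car -> rm_car -> rm_car;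
  rm_one : rm_car;
  rm_size : rm_car -> nat;
  rm_conn : rm_car -> Prop;
  rm_refl : forall x, rm_eq x x;
  rm_sym : forall x y, rm_eq x y -> rm_eq y x;
  rm_trans : forall y x z, rm_eq x y -> rm_eq y z -> rm_eq x z;
  rm_mul_eq : forall x x' y y',
    rm_eq x x' -> rm_eq y y' -> rm_eq (rm_mul x y) (rm_mul x' y');
  rm_mulC : forall x y, rm_eq (rm_mul x y) (rm_mul y x);
  rm_mulA : forall x y z,
    rm_eq (rm_mul x (rm_mul y z)) (rm_mul (rm_mul x y) z);
  rm_size_one : rm_size rm_one = 1;
  rm_mul_unitl : forall x y, rm_size y = 1 -> rm_eq (rm_mul y x) x;
  rm_size_eq : forall x y, rm_eq x y -> rm_size x = rm_size y;
  rm_sizeM : forall x y, rm_size (rm_mul x y) = rm_size x * rm_size y;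
  rm_conn_eq : forall x y, rm_eq x y -> rm_conn x -> rm_conn y;
  rm_conn_gt0 : forall x, rm_conn x -> 0 < rm_size x;
  rm_connM : forall x y, rm_conn (rm_mul x y) -> rm_conn x /\ rm_conn y;
  rm_refine : forall a b c d,
    rm_conn (rm_mul a b) -> rm_eq (rm_mul a b) (rm_mul c d) ->
    exists x y z w,
      [/\ rm_eq a (rm_mul x y), rm_eq b (rm_mul z w),
          rm_eq c (rm_mul x z) & rm_eq d (rm_mul y w)] }.

Definition rm_prod (M : refinement_monoid) (s : seq M) : M :=
  foldr (@rm_mul M) (rm_one M) s.

Definition rm_atom (M : refinement_monoid) (x : M) : Prop :=
  1 < rm_size x /\
  ~ exists a b : M, [/\ 1 < rm_size a, 1 < rm_size b & rm_eq x (rm_mul a b)].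

Lemma In_cat (A : Type) (x : A) (s t : seq A) :
  List.In x (s ++ t) <-> List.In x s \/ List.In x t.
Proof. by elim: s => [|y s IH] /=; rewrite ?IH; tauto. Qed.

Lemma rm_mul_unitr (M : refinement_monoid) (x y : M) :
  rm_size y = 1 -> rm_eq (rm_mul x y) x.
Proof. by move=> y1; apply: rm_trans (rm_mulC _ _) (rm_mul_unitl _ y1). Qed.

Lemma rm_prod_cat (M : refinement_monoid) (s t : seq M) :
  rm_eq (rm_prod (s ++ t)) (rm_mul (rm_prod s) (rm_prod t)).
Proof.
elim: s => [|x s IH] /=.
  exact: rm_sym (rm_mul_unitl _ (rm_size_one M)).
apply: rm_trans (rm_mulA _ _ _).
exact: rm_mul_eq (rm_refl x) IH.
Qed.

(** Connected elements have positive size, so a factor of size at most 1 has size exactly 1 and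
    drops out as a unit. *)
Lemma rm_atom_split (M : refinement_monoid) (p x y : M) :
  rm_conn p -> rm_atom p -> rm_eq p (rm_mul x y) ->
  (rm_size x = 1 /\ rm_eq p y) \/ (rm_size y = 1 /\ rm_eq p x).
Proof.
move=> cp [_ p_irr] pxy; have [cx cy] := rm_connM (rm_conn_eq pxy cp).
have [x1|x1] := leqP (rm_size x) 1.
  have {}x1 : rm_size x = 1 by apply/eqP; rewrite eqn_leq x1 rm_conn_gt0.
  by left; split=> //; apply: rm_trans pxy (rm_mul_unitl _ x1).
have [y1|y1] := leqP (rm_size y) 1; last by case: p_irr; exists x, y.
have {}y1 : rm_size y = 1 by apply/eqP; rewrite eqn_leq y1 rm_conn_gt0.
by right; split=> //; apply: rm_trans pxy (rm_mul_unitr _ y1).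
Qed.

(* Refinement makes atoms prime and cancellable at once. *)
Lemma rm_atom_cancel (M : refinement_monoid) (p b : M) (s : seq M) :
  rm_conn (rm_mul p b) -> rm_atom p -> (forall t, List.In t s -> rm_atom t) ->
  rm_eq (rm_mul p b) (rm_prod s) ->
  exists s1 t s2,
    [/\ s = s1 ++ t :: s2, rm_eq p t & rm_eq b (rm_prod (s1 ++ s2))].
Proof.
elim: s b => [|t s IH] b cpb pA sA eb.
  have := rm_size_eq eb; rewrite /= rm_size_one rm_sizeM => /eqP.
  by rewrite muln_eq1 => /andP[/eqP p1 _]; case: pA; rewrite p1.
have [x [y [z [w [pxy bzw txz syw]]]]] := rm_refine cpb eb.
have [cp cb] := rm_connM cpb.
have [ct cs] := rm_connM (rm_conn_eq eb cpb).
(* Either [p] is the piece [y] of the tail, where induction finds its match while [t] goes into [b];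
   or [p] is the piece [x] of [t], and then [p] and [t] are equal because [t] is an atom too. *)
have [[x1 py]|[y1 px]] := rm_atom_split cp pA pxy.
  have spw : rm_eq (rm_mul p w) (rm_prod s).
    by apply: rm_trans (rm_sym syw); apply: rm_mul_eq py (rm_refl w).
  have tz : rm_eq t z by apply: rm_trans txz (rm_mul_unitl _ x1).
  have [||s1 [t' [s2 [-> pt' ws]]]] := IH w _ pA _ spw.
  - exact: rm_conn_eq (rm_sym spw) cs.
  - by move=> u us; apply: sA; right.
  exists (t :: s1), t', s2; split=> //=; apply: rm_trans bzw _.
  exact: rm_mul_eq (rm_sym tz) ws.
have [|[x1 _]|[z1 tx]] := rm_atom_split ct _ txz; first by apply: sA; left.
  by case: pA => [p1 _]; rewrite (rm_size_eq px) x1 in p1.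
exists [::], t, s; split=> //=; first exact: rm_trans px (rm_sym tx).
apply: rm_trans bzw _; apply: rm_trans (rm_mul_unitl _ z1) _.
by apply: rm_trans (rm_sym syw); apply: rm_sym (rm_mul_unitl _ y1).
Qed.

Lemma rm_factorization_unique (M : refinement_monoid) (s t : seq M) :
  rm_conn (rm_prod s) -> (forall x, List.In x s -> rm_atom x) ->
  (forall x, List.In x t -> rm_atom x) ->
  rm_eq (rm_prod s) (rm_prod t) -> perm_up (@rm_eq M) s t.
Proof.
elim: s t => [|p s IH] t cs sA tA e.
  case: t tA e => [|q t] tA e; first exact: perm_up_nil.
  have := rm_size_eq e; rewrite /= rm_size_one rm_sizeM => /esym/eqP.
  rewrite muln_eq1 => /andP[/eqP q1 _].
  by have [|] := tA q; [left | rewrite q1].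
have [|t1 [q [t2 [tE pq st]]]] := rm_atom_cancel cs _ tA e.
  by apply: sA; left.
rewrite {}tE in tA *; apply: perm_up_cons => //; apply: IH => //.
- by have [_] := rm_connM cs.
- by move=> x xs; apply: sA; right.
- by move=> x; rewrite In_cat => xt; apply: tA; rewrite In_cat /=; tauto.
Qed.

Lemma rm_factorization_exists (M : refinement_monoid) (x : M) :
  rm_conn x -> 1 < rm_size x ->
  exists s : seq M, [/\ 0 < size s, forall y, List.In y s -> rm_atom y
    & rm_eq x (rm_prod s)].
Proof.
have [n] := ubnP (rm_size x); elim: n x => // n IH x xn cx x1.
(* Splitting quantifies over all elements, so the case distinction is classical. Sizes multiply,
   hence both factors are smaller than [x]. *)
have [[a [b [a1 b1 e]]]|x_irr] := classic (exists a b : M,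
    [/\ 1 < rm_size a, 1 < rm_size b & rm_eq x (rm_mul a b)]); last first.
  exists [:: x]; split=> //= [y [<-|//]|]; first by split.
  exact: rm_sym (rm_mul_unitr _ (rm_size_one M)).
have [ca cb] := rm_connM (rm_conn_eq e cx).
have xab : rm_size x = rm_size a * rm_size b by rewrite (rm_size_eq e) rm_sizeM.
have [|s [s0 sA es]] := IH a _ ca a1.
  by apply: leq_trans (xn : _ <= n); rewrite xab ltn_Pmulr // ltnW.
have [|t [t0 tA et]] := IH b _ cb b1.
  by apply: leq_trans (xn : _ <= n); rewrite xab ltn_Pmull // ltnW.
exists (s ++ t); split.
- by rewrite size_cat addn_gt0 s0.
- by move=> y /In_cat[/sA|/tA].
- apply: rm_trans e _; apply: rm_trans (rm_sym (rm_prod_cat _ _)).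
  exact: rm_mul_eq.
Qed.

(** * The monoids of signed graphs and of graphs *)

Lemma proper_conn_sequiv S T : sequiv S T -> proper_conn S -> proper_conn T.
Proof.
move=> /[dup] /sequiv_card cST /sequivE[f [g [t [fK gK fadj _]]]] [S0 cS].
split=> [|x y]; first by rewrite -cST.
have [n] := cS (g x) (g y); rewrite (@walk_iso _ (sg T) f); last 2 first.
- by exists g.
- by [].
by rewrite !gK; exists n.
Qed.

Lemma proper_conn_sgprod S T :
  proper_conn (sgprod S T) -> proper_conn S /\ proper_conn T.
Proof.
case=> /card_gt0P[[a b] _] cST; split; split.
- by apply/card_gt0P; exists a.
- move=> x y; have [n /walk_gprodP[k [l [_ wk _]]]] := cST (x, b) (y, b).
  by exists k.
- by apply/card_gt0P; exists b.
- move=> x y; have [n /walk_gprodP[k [l [_ _ wl]]]] := cST (a, x) (a, y).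
  by exists l.
Qed.

(** Kept transparent so that [rm_eq], [rm_mul] and [rm_conn] convert to the notions for signed
    graphs. *)
Definition sgraph_monoid : refinement_monoid.
Proof.
apply: (@RefinementMonoid sgraph sequiv sgprod sK1 (fun S => #|gV (sg S)|)
  proper_conn sequiv_refl sequiv_sym sequiv_trans sequiv_sgprod sgprodC sgprodA
  card_unit sgprod_trivl sequiv_card _ proper_conn_sequiv _ proper_conn_sgprod
  sgprod_refinement).
- by move=> S T; apply: card_prod.
- by move=> S [].
Defined.

(** The all-positive signature, through which results on signed graphs carry over to graphs. *)
Definition triv (G : graph) : sgraph :=
  @SGraph G (fun _ _ => false) (fun _ _ => erefl).

Lemma sequiv_giso S T : sequiv S T -> giso (sg S) (sg T).
Proof. by case=> f [bf fadj _]; exists f. Qed.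

Lemma giso_sequiv G H : giso G H -> sequiv (triv G) (triv H).
Proof.
case=> f [bf fadj]; exists f; split=> //.
by exists set0 => u v _; rewrite !inE.
Qed.

Lemma triv_gprod G H : sequiv (triv (gprod G H)) (sgprod (triv G) (triv H)).
Proof.
exists id; split=> //; first by exists id.
by exists set0 => u v _; rewrite !inE /= /sgprod_sgn if_same.
Qed.

(** Refine the all-positive signed graphs, then forget the signatures of the four pieces. *)
Lemma gprod_refinement (A B C E : graph) :
  proper_conn (triv (gprod A B)) -> giso (gprod A B) (gprod C E) ->
  exists X Y Z W : graph,
    [/\ giso A (gprod X Y), giso B (gprod Z W),
        giso C (gprod X Z) & giso E (gprod Y W)].
Proof.
move=> cAB /giso_sequiv e.
have e' : sequiv (sgprod (triv A) (triv B)) (sgprod (triv C) (triv E)).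
  apply: sequiv_trans (triv_gprod _ _); apply: sequiv_trans e.
  exact: sequiv_sym (triv_gprod _ _).
have [X [Y [Z [W [eA eB eC eE]]]]] := @sgprod_refinement (triv A) (triv B) _ _ cAB e'.
exists (sg X), (sg Y), (sg Z), (sg W).
by split; [move: eA | move: eB | move: eC | move: eE] => /sequiv_giso.
Qed.

Definition graph_monoid : refinement_monoid.
Proof.
apply: (@RefinementMonoid graph giso gprod K1 (fun G => #|gV G|)
  (fun G => proper_conn (triv G)) _ _ _ _ _ _ card_unit _ _ _ _ _ _
  gprod_refinement).
- by move=> G; apply: sequiv_giso (sequiv_refl (triv G)).
- by move=> G H /giso_sequiv/sequiv_sym/sequiv_giso.
- move=> H G K /giso_sequiv GH /giso_sequiv HK.
  exact: sequiv_giso (sequiv_trans GH HK).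
- move=> G G' H H' /giso_sequiv GG' /giso_sequiv HH'.
  exact: sequiv_giso (sequiv_sgprod GG' HH').
- by move=> G H; apply: sequiv_giso (sgprodC (triv G) (triv H)).
- by move=> G H K; apply: sequiv_giso (sgprodA (triv G) (triv H) (triv K)).
- by move=> G H H1; apply: sequiv_giso (@sgprod_trivl (triv G) (triv H) H1).
- by move=> G H /giso_sequiv/sequiv_card.
- by move=> G H; apply: card_prod.
- by move=> G H /giso_sequiv; apply: proper_conn_sequiv.
- by move=> G [].
- by move=> G H; apply: (@proper_conn_sgprod (triv G) (triv H)).
Defined.

(** * Prime decompositions as factorizations into atoms *)

Lemma sgprodl_prod (s : seq sgraph) :
  sequiv (sgprodl s) (@rm_prod sgraph_monoid s).
Proof.
elim: s => [|T [|U s] IH]; first exact: sequiv_refl.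
  (* [sgprodl] ends with its last factor, [rm_prod] with a further unit, which is absorbed here. *)
  exact: sequiv_sym (@rm_mul_unitr sgraph_monoid T sK1 card_unit).
exact: sequiv_sgprod (sequiv_refl T) IH.
Qed.

Lemma gprodl_prod (s : seq graph) :
  giso (gprodl s) (@rm_prod graph_monoid s).
Proof.
elim: s => [|T [|U s] IH]; first exact: (@rm_refl graph_monoid).
  exact: (@rm_sym graph_monoid _ _ (@rm_mul_unitr graph_monoid T K1 card_unit)).
exact: (@rm_mul_eq graph_monoid _ _ _ _ (@rm_refl graph_monoid T) IH).
Qed.

Lemma sg_sgprodl (s : seq sgraph) : sg (sgprodl s) = gprodl (map sg s).
Proof. by elim: s => [|T [|U s] IH] //; apply: congr1 IH. Qed.

Lemma has_edge_card_gt1 (G : graph) : has_edge G -> 1 < #|gV G|.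
Proof.
case=> u [v uv]; apply/card_gt1P; exists u, v; split=> //.
by apply: contraTneq uv => ->; rewrite gadj_irr.
Qed.

Lemma card_gt1_has_edge (G : graph) :
  walk_connected G -> 1 < #|gV G| -> has_edge G.
Proof.
move=> cG /card_gt1P[u [v [_ _ uv]]]; have [[|n] /=] := cG u v.
  by rewrite (negPf uv).
by case/existsP=> w /andP[uw _]; exists u, w.
Qed.

Lemma rm_prod_conn (M : refinement_monoid) (s : seq M) x :
  rm_conn (rm_prod s) -> List.In x s -> rm_conn x.
Proof. by elim: s => //= y s IH /rm_connM[cy cs] [<-|/(IH cs)]. Qed.

(** Decompositions ask factors to have an edge, atoms to have more than one vertex; for factors of a
    connected graph these agree. *)
Lemma prime_sdecompP (S : sgraph) (D : seq sgraph) : proper_conn S ->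
  is_prime_sdecomp S D <->
  [/\ 0 < size D, forall T, List.In T D -> @rm_atom sgraph_monoid T
     & sequiv S (@rm_prod sgraph_monoid D)].
Proof.
move=> cS; split.
  case=> -[D0 De SD] Dp; split=> //.
    by move=> T TD; split; [apply/has_edge_card_gt1/De | apply: Dp].
  exact: sequiv_trans SD (sgprodl_prod D).
case=> D0 Da SD; split; last by move=> T /Da[].
split=> //; last exact: sequiv_trans SD (sequiv_sym (sgprodl_prod D)).
move=> T TD; have [T1 _] := Da T TD; apply: card_gt1_has_edge => //.
have cD := @rm_conn_eq sgraph_monoid _ _ SD cS.
by have [] := @rm_prod_conn sgraph_monoid _ _ cD TD.
Qed.

Lemma prime_decompP (G : graph) (D : seq graph) : proper_conn (triv G) ->
  is_prime_decomp G D <->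
  [/\ 0 < size D, forall H, List.In H D -> @rm_atom graph_monoid H
     & giso G (@rm_prod graph_monoid D)].
Proof.
move=> cG; split.
  case=> -[D0 De GD] Dp; split=> //.
    by move=> H HD; split; [apply/has_edge_card_gt1/De | apply: Dp].
  exact: (@rm_trans graph_monoid _ _ _ GD (gprodl_prod D)).
case=> D0 Da GD; split; last by move=> H /Da[].
split=> //; last first.
  exact: (@rm_trans graph_monoid _ _ _ GD
           (@rm_sym graph_monoid _ _ (gprodl_prod D))).
move=> H HD; have [H1 _] := Da H HD; apply: card_gt1_has_edge => //.
have cD := @rm_conn_eq graph_monoid _ _ GD cG.
by have [] := @rm_prod_conn graph_monoid _ _ cD HD.
Qed.

(** Each graph is factored separately; concatenating the lists factors the whole product into atoms,
    which uniqueness can compare with any other prime decomposition. *)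
Lemma prime_decomp_all (Ds : seq graph) :
  (forall H, List.In H Ds -> proper_conn (triv H) /\ 1 < #|gV H|) ->
  exists P : seq (seq graph),
    [/\ size P = size Ds,
        forall i, i < size Ds -> is_prime_decomp (nth K1 Ds i) (nth [::] P i),
        forall H, List.In H (flatten P) -> @rm_atom graph_monoid H
      & giso (@rm_prod graph_monoid Ds) (@rm_prod graph_monoid (flatten P))].
Proof.
elim: Ds => [|H Ds IH] cDs.
  by exists [::]; split=> //; apply: (@rm_refl graph_monoid).
have [|P [sP dP aP eP]] := IH; first by move=> K KD; apply: cDs; right.
have [cH H1] : proper_conn (triv H) /\ 1 < #|gV H| by apply: cDs; left.
have [s [s0 sA es]] := @rm_factorization_exists graph_monoid H cH H1.
exists (s :: P); split=> /=.
- by rewrite sP.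
- by case=> [|i] iD; [apply/prime_decompP | apply: dP].
- by move=> K /In_cat[/sA|/aP].
- apply: (@rm_trans graph_monoid _ _ _ _
           (@rm_sym graph_monoid _ _ (@rm_prod_cat graph_monoid _ _))).
  exact: (@rm_mul_eq graph_monoid _ _ _ _ es eP).
Qed.

Theorem theorem4p9 (S : sgraph) (D : seq graph) :
  gconnected (sg S) -> has_edge (sg S) ->
  is_prime_decomp (sg S) D ->
  exists Ds : seq sgraph,
    [/\ is_prime_sdecomp S Ds,
        (forall Ds' : seq sgraph, is_prime_sdecomp S Ds' -> perm_up sequiv Ds Ds')
      & finer D (map sg Ds)].
Proof.
move=> cS eS dD; have S1 := has_edge_card_gt1 eS.
have pcS : proper_conn S by split; [apply: ltnW | apply: gconnected_walk].
have [Ds [Ds0 Dsa eDs]] := @rm_factorization_exists sgraph_monoid S pcS S1.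
have cDs := @rm_conn_eq sgraph_monoid _ _ eDs pcS.
have pDs : is_prime_sdecomp S Ds by apply/prime_sdecompP.
exists Ds; split=> //.
  move=> Ds' /(prime_sdecompP _ pcS)[_ Dsa' eDs'].
  apply: (@rm_factorization_unique sgraph_monoid) => //.
  exact: sequiv_trans (sequiv_sym eDs) eDs'.
(* [P] decomposes the underlying graph of each factor in [Ds]; it remains to match [D] with
   [flatten P]. *)
have [|P [sP dP aP eP]] := @prime_decomp_all (map sg Ds).
  move=> _ /List.in_map_iff[T [<- TD]]; have [T1 _] := Dsa T TD.
  by split=> //; apply: (@rm_prod_conn sgraph_monoid _ _ cDs TD).
exists P; split=> //.
  by move=> i /dP[].
have pcG : proper_conn (triv (sg S)) := pcS.
have [_ aD eD] := (prime_decompP D pcG).1 dD.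
(* [D] and [flatten P] both factor [sg S] into atoms, the latter through the underlying graphs of
   [Ds]. *)
apply: (@rm_factorization_unique graph_monoid) => //.
  exact: (@rm_conn_eq graph_monoid _ _ eD pcG).
apply: (@rm_trans graph_monoid _ _ _ (@rm_sym graph_monoid _ _ eD)).
apply: (@rm_trans graph_monoid _ _ _ _ eP).
have [[_ _ /sequiv_giso eSD] _] := pDs; rewrite sg_sgprodl in eSD.
exact: (@rm_trans graph_monoid _ _ _ eSD (gprodl_prod _)).
Qed.
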